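(* For every nonempty compact Hausdorff space $K$, the set $\mathrm{BS}_a(C(K),\mathbb{R})$ is weak-$*$-dense in $C(K)^*=\mathcal{L}(C(K),\mathbb{R})$. In particular, $\mathrm{BS}_a(\ell_\infty,\mathbb{R})$ is weak-$*$-dense in $\mathcal{L}(\ell_\infty,\mathbb{R})$.
   Context: All Banach spaces are real; $C(K)$ is the space of real-valued continuous functions on $K$ with the supremum norm. $S_X$ is the unit sphere of $X$, and $\mathcal{L}(X,Y)$ is the space of bounded linear operators from $X$ to $Y$ with the operator norm, so $\mathcal{L}(X,\mathbb{R})=X^*$. For $T\in\mathcal{L}(X,Y)$ put $M_T=\{x\in S_X:\|Tx\|=\|T\|\}$; $T$ attains its norm if $M_T\neq\emptyset$, and $\mathrm{NA}(X,Y)$ is the set of norm attaining operators. For vectors $x,y$ of a Banach space: $x\perp_B y$ means $\|x\|\le\|x+\lambda y\|$ for all $\lambda\in\mathbb{R}$; $x\perp_S y$ means $\|x\|<\|x+\lambda y\|$ for all $\lambda\in\mathbb{R}\setminus\{0\}$. $\mathrm{BS}_a(X,Y)$ (operators with the adjusted Bhatia-Šemrl property) is the set of $T\in\mathrm{NA}(X,Y)$ such that for every $S\in\mathcal{L}(X,Y)$ with $T\perp_S S$ there is $x_0\in M_T$ with $Tx_0\perp_B Sx_0$. *)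

(* Defs.v *)
From HB Require Import structures.
From mathcomp Require Import all_boot all_order all_algebra.
From mathcomp Require Import all_classical all_reals all_analysis.
Set Implicit Arguments.
Unset Strict Implicit.
Unset Printing Implicit Defensive.
Import Order.TTheory GRing.Theory Num.Theory.
Import numFieldNormedType.Exports.
Local Open Scope classical_set_scope.
Local Open Scope ring_scope.

(* Suprema of `|f t|, the common part of the three norms below. *)
Section sup_norm.
Variables (R : realType) (T : Type) (V : normedModType R).
Implicit Types (f g : T -> V) (A : set T).

Definition sup_norm A f : R := sup [set `|f t| | t in A].

Definition bounded_in A f := exists M : R, forall t, A t -> `|f t| <= M.

Lemma sup_norm_ub A f t : bounded_in A f -> A t -> `|f t| <= sup_norm A f.
Proof.
move=> [M fM] At; apply: ub_le_sup; last by exists t.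
by exists M => _ [s As <-]; exact: fM.
Qed.

Lemma sup_norm_le A f (M : R) : 0 <= M ->
  (forall t, A t -> `|f t| <= M) -> sup_norm A f <= M.
Proof.
move=> M0 fM; rewrite /sup_norm.
have [->|A0] := eqVneq [set `|f t| | t in A] set0; first by rewrite sup0.
by apply: ge_sup => [|_ [t At <-]]; [exact/set0P|exact: fM].
Qed.

Lemma sup_norm_ge0 A f : 0 <= sup_norm A f.
Proof.
rewrite /sup_norm; set B := image _ _.
have [bB|bB] := pselect (has_sup B); last by rewrite sup_out.
have [_ [t At _]] := bB.1.
by rewrite (le_trans (normr_ge0 (f t)))// (ub_le_sup bB.2)//; exists t.
Qed.

Lemma sup_normD A f g : bounded_in A f -> bounded_in A g ->
  sup_norm A (f \+ g) <= sup_norm A f + sup_norm A g.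
Proof.
move=> bf bg; apply: sup_norm_le => [|t At].
  by rewrite addr_ge0// sup_norm_ge0.
by rewrite (le_trans (ler_normD _ _))// lerD// sup_norm_ub.
Qed.

Lemma sup_normZ A f (k : R) : bounded_in A f ->
  sup_norm A (k \*: f) = `|k| * sup_norm A f.
Proof.
move=> bf; have bkf : bounded_in A (k \*: f).
  case: bf => M fM; exists (`|k| * M) => t At /=.
  by rewrite normrZ ler_wpM2l// fM.
apply/le_anti/andP; split.
  apply: sup_norm_le => [|t At]; first by rewrite mulr_ge0// sup_norm_ge0.
  by rewrite /= normrZ ler_wpM2l// sup_norm_ub.
have [->|k0] := eqVneq k 0; first by rewrite normr0 mul0r sup_norm_ge0.
rewrite -ler_pdivlMl ?normr_gt0//; apply: sup_norm_le => [|t At].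
  by rewrite mulr_ge0 ?invr_ge0 ?normr_ge0 ?sup_norm_ge0.
by rewrite ler_pdivlMl ?normr_gt0// -normrZ (sup_norm_ub bkf).
Qed.

Lemma sup_norm_eq0 A f : bounded_in A f -> sup_norm A f = 0 ->
  forall t, A t -> f t = 0.
Proof.
move=> bf f0 t At; apply/eqP; rewrite -normr_le0 -f0; exact: sup_norm_ub.
Qed.

End sup_norm.

(* C(K) with the supremum norm, for cK a proof that K is compact. *)
Definition Cspace (R : realType) (K : topologicalType)
  (cK : compact [set: K]) : Type := continuousType K R^o.

Section Cspace.
Variables (R : realType) (K : topologicalType) (cK : compact [set: K]).
Local Notation CK := (Cspace R cK).

HB.instance Definition _ := Choice.on CK.

Lemma Cspace_cts (f : CK) : continuous f.
Proof. exact: (@cts_fun _ _ f). Qed.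

Lemma Cspace_ext (f g : CK) : f =1 g -> f = g.
Proof. by move=> fg; apply/(@continuousEP K R^o f g). Qed.

Definition Cspace_mk (f : K -> R^o) (cf : continuous f) : CK :=
  (mkcts cf : continuousType K R^o).

Let cst_cts : continuous (fun _ : K => 0 : R^o).
Proof. by move=> x; exact: cvg_cst. Qed.

Let add_cts (f g : CK) : continuous (fun x => f x + g x).
Proof. by move=> x; apply: cvgD; exact: Cspace_cts. Qed.

Let opp_cts (f : CK) : continuous (fun x => - f x).
Proof. by move=> x; apply: cvgN; exact: Cspace_cts. Qed.

Let scale_cts (k : R) (f : CK) : continuous (fun x => k *: f x).
Proof. by move=> x; apply: cvgZr; exact: Cspace_cts. Qed.

Let addCA : associative (fun f g => Cspace_mk (@add_cts f g)).
Proof. by move=> f g h; apply: Cspace_ext => x; exact: addrA. Qed.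
Let addCC : commutative (fun f g => Cspace_mk (@add_cts f g)).
Proof. by move=> f g; apply: Cspace_ext => x; exact: addrC. Qed.
Let add0C : left_id (Cspace_mk cst_cts) (fun f g => Cspace_mk (@add_cts f g)).
Proof. by move=> f; apply: Cspace_ext => x; exact: add0r. Qed.
Let addNC : left_inverse (Cspace_mk cst_cts) (fun f => Cspace_mk (@opp_cts f))
  (fun f g => Cspace_mk (@add_cts f g)).
Proof. by move=> f; apply: Cspace_ext => x; exact: addNr. Qed.

HB.instance Definition _ := GRing.isZmodule.Build CK addCA addCC add0C addNC.

Let scaleCA (a b : R) (f : CK) :
  Cspace_mk (@scale_cts a (Cspace_mk (@scale_cts b f))) =
  Cspace_mk (@scale_cts (a * b) f).
Proof. by apply: Cspace_ext => x; exact: scalerA. Qed.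
Let scale1C : left_id 1 (fun k f => Cspace_mk (@scale_cts k f)).
Proof. by move=> f; apply: Cspace_ext => x; exact: scale1r. Qed.
Let scaleCDr : right_distributive (fun k f => Cspace_mk (@scale_cts k f)) +%R.
Proof. by move=> k f g; apply: Cspace_ext => x; exact: scalerDr. Qed.
Let scaleCDl (f : CK) :
  {morph (fun k => Cspace_mk (@scale_cts k f)) : a b / a + b}.
Proof. by move=> a b; apply: Cspace_ext => x; exact: scalerDl. Qed.

HB.instance Definition _ :=
  GRing.Zmodule_isLmodule.Build R CK scaleCA scale1C scaleCDr scaleCDl.

Lemma Cspace_bounded (f : CK) : bounded_in setT f.
Proof.
have /compact_bounded[M [_ fM]] : compact (f @` [set: K]).
  apply: continuous_compact cK; apply: continuous_subspaceT.
  exact: Cspace_cts.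
exists (M + 1) => x _; apply: (fM (M + 1)); first by rewrite ltrDl.
by exists x.
Qed.

Let normD (f g : CK) :
  sup_norm setT (f + g) <= sup_norm setT f + sup_norm setT g.
Proof. by apply: sup_normD; exact: Cspace_bounded. Qed.

Let normZ (k : R) (f : CK) : sup_norm setT (k *: f) = `|k| * sup_norm setT f.
Proof. by apply: sup_normZ; exact: Cspace_bounded. Qed.

Let norm_eq0 (f : CK) : sup_norm setT f = 0 -> f = 0.
Proof.
move=> f0; apply: Cspace_ext => x.
by apply: (sup_norm_eq0 _ f0) => //; exact: Cspace_bounded.
Qed.

HB.instance Definition _ := Lmodule_isNormed.Build R CK normD normZ norm_eq0.

Lemma Cspace_normE (f : CK) : `|f| = sup [set `|f x| | x in setT].
Proof. by []. Qed.

End Cspace.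

Definition bounded_seq {R : realType} : {pred nat -> R^o} :=
  [pred u : nat -> R^o | `[< bounded_fun u >]].

(* l^oo: bounded real sequences with the supremum norm. *)
Definition linfty (R : realType) : Type :=
  {u : nat -> R^o | u \in @bounded_seq R}.

Section linfty.
Variable R : realType.
Local Notation linf := (linfty R).

Lemma bounded_seqP (u : nat -> R^o) :
  u \in bounded_seq <-> bounded_in setT u.
Proof.
split=> [/asboolP[M [_ uM]]|[M uM]].
  exists (M + 1) => n _; apply: (uM (M + 1)) => //; by rewrite ltrDl.
apply/asboolP; exists M; split; first exact: num_real.
by move=> N MN n _ /=; rewrite (le_trans (uM n I))// ltW.
Qed.

Fact bounded_seq_submod_closed : submod_closed (@bounded_seq R).
Proof.
split=> [|k u v /bounded_seqP[M uM] /bounded_seqP[N vN]]; apply/bounded_seqP.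
  by exists 0 => n _; rewrite normr0.
exists (`|k| * M + N) => n _; rewrite (le_trans (ler_normD _ _))//.
by rewrite lerD ?vN// normrZ ler_wpM2l// uM.
Qed.

HB.instance Definition _ :=
  GRing.isSubmodClosed.Build R (nat -> R^o) bounded_seq
    bounded_seq_submod_closed.

HB.instance Definition _ := SubChoice.on linf.
HB.instance Definition _ := [SubChoice_isSubLmodule of linf by <:].

Definition linfty_fun (u : linf) : nat -> R^o := \val u.
Coercion linfty_fun : linfty >-> Funclass.

Lemma linfty_bounded (u : linf) : bounded_in setT u.
Proof. by apply/bounded_seqP; exact: valP. Qed.

Let normD (u v : linf) :
  sup_norm setT (u + v : linf) <= sup_norm setT u + sup_norm setT v.
Proof. by apply: sup_normD; exact: linfty_bounded. Qed.

Let normZ (k : R) (u : linf) :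
  sup_norm setT (k *: u : linf) = `|k| * sup_norm setT u.
Proof. by apply: sup_normZ; exact: linfty_bounded. Qed.

Let norm_eq0 (u : linf) : sup_norm setT u = 0 -> u = 0.
Proof.
move=> u0; apply/val_inj/funext => n.
by apply: (sup_norm_eq0 _ u0) => //; exact: linfty_bounded.
Qed.

HB.instance Definition _ := Lmodule_isNormed.Build R linf normD normZ norm_eq0.

Lemma linfty_normE (u : linf) : `|u| = sup [set `|u n| | n in setT].
Proof. by []. Qed.

End linfty.

HB.mixin Record isBoundedOperator (R : realType) (X Y : normedModType R)
    (T : X -> Y) := {
  operator_bounded : exists M : R, forall x, `|T x| <= M * `|x|
}.

(* L(X, Y); the norm below is the operator norm. *)
#[short(type="boundedOperator")]
HB.structure Definition BoundedOperator (R : realType)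
    (X Y : normedModType R) :=
  {T of @GRing.Linear R X Y *:%R T & isBoundedOperator R X Y T}.

Notation "''L' ( X , Y )" := (boundedOperator X Y)
  (at level 8, format "''L' ( X ,  Y )") : type_scope.

Section boundedOperator.
Variables (R : realType) (X Y : normedModType R).
Implicit Types S T : 'L(X, Y).

HB.instance Definition _ := gen_eqMixin 'L(X, Y).
HB.instance Definition _ := gen_choiceMixin 'L(X, Y).

Lemma boundedOperator_ext S T : S =1 T -> S = T.
Proof.
case: S T => [S [[S1] [S2] [S3]]] [T [[T1] [T2] [T3]]] /= /funext ST.
rewrite ST in S1 S2 S3 *.
by congr BoundedOperator.Pack; congr BoundedOperator.Class; congr (_ _);
  exact: Prop_irrelevance.
Qed.

Section operations.
Variables (k : R) (S T : 'L(X, Y)).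

Let zero_bounded : exists M : R, forall x, `|(\0 : X -> Y) x| <= M * `|x|.
Proof. by exists 0 => x; rewrite normr0 mul0r. Qed.
HB.instance Definition _ := isBoundedOperator.Build R X Y \0 zero_bounded.

Let add_bounded : exists M : R, forall x, `|(S \+ T) x| <= M * `|x|.
Proof.
have [M SM] := @operator_bounded _ _ _ S.
have [N TN] := @operator_bounded _ _ _ T.
exists (M + N) => x; rewrite mulrDl (le_trans (ler_normD _ _))//.
by rewrite lerD.
Qed.
HB.instance Definition _ := isBoundedOperator.Build R X Y (S \+ T) add_bounded.

Let opp_bounded : exists M : R, forall x, `|(\- S) x| <= M * `|x|.
Proof.
by have [M SM] := @operator_bounded _ _ _ S; exists M => x; rewrite /= normrN.
Qed.
HB.instance Definition _ := isBoundedOperator.Build R X Y (\- S) opp_bounded.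

Let scale_bounded : exists M : R, forall x, `|(k \*: S) x| <= M * `|x|.
Proof.
have [M SM] := @operator_bounded _ _ _ S.
by exists (`|k| * M) => x; rewrite /= normrZ -mulrA ler_wpM2l.
Qed.
HB.instance Definition _ := isBoundedOperator.Build R X Y (k \*: S) scale_bounded.

Definition zero_op : 'L(X, Y) := (\0 : X -> Y).
Definition add_op : 'L(X, Y) := S \+ T.
Definition opp_op : 'L(X, Y) := \- S.
Definition scale_op : 'L(X, Y) := k \*: S.
End operations.

Let addLA : associative add_op.
Proof. by move=> ? ? ?; apply: boundedOperator_ext => x; exact: addrA. Qed.
Let addLC : commutative add_op.
Proof. by move=> ? ?; apply: boundedOperator_ext => x; exact: addrC. Qed.
Let add0L : left_id zero_op add_op.
Proof. by move=> ?; apply: boundedOperator_ext => x; exact: add0r. Qed.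
Let addNL : left_inverse zero_op opp_op add_op.
Proof. by move=> ?; apply: boundedOperator_ext => x; exact: addNr. Qed.

HB.instance Definition _ :=
  GRing.isZmodule.Build 'L(X, Y) addLA addLC add0L addNL.

Let scaleLA a b T : scale_op a (scale_op b T) = scale_op (a * b) T.
Proof. by apply: boundedOperator_ext => x; exact: scalerA. Qed.
Let scale1L : left_id 1 scale_op.
Proof. by move=> ?; apply: boundedOperator_ext => x; exact: scale1r. Qed.
Let scaleLDr : right_distributive scale_op +%R.
Proof. by move=> ? ? ?; apply: boundedOperator_ext => x; exact: scalerDr. Qed.
Let scaleLDl T : {morph scale_op^~ T : a b / a + b}.
Proof. by move=> ? ?; apply: boundedOperator_ext => x; exact: scalerDl. Qed.

HB.instance Definition _ := GRing.Zmodule_isLmodule.Build R 'L(X, Y)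
  scaleLA scale1L scaleLDr scaleLDl.

Lemma operator_bounded_in T : bounded_in [set x | `|x| <= 1] T.
Proof.
have [M TM] := @operator_bounded _ _ _ T.
exists `|M| => x /= x1; rewrite (le_trans (TM x))//.
by rewrite (le_trans (ler_norm _))// normrM normr_id ler_piMr.
Qed.

Definition operator_norm T : R := sup_norm [set x | `|x| <= 1] T.

Let normD S T : operator_norm (S + T) <= operator_norm S + operator_norm T.
Proof. by apply: sup_normD; exact: operator_bounded_in. Qed.

Let normZ (k : R) T : operator_norm (k *: T) = `|k| * operator_norm T.
Proof. by apply: sup_normZ; exact: operator_bounded_in. Qed.

Let norm_eq0 T : operator_norm T = 0 -> T = 0.
Proof.
move=> T0; apply: boundedOperator_ext => x.
have [->|x0] := eqVneq x 0; first by rewrite !linear0.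
have : T (`|x|^-1 *: x) = 0.
  apply: (sup_norm_eq0 _ T0); first exact: operator_bounded_in.
  by rewrite /= normfZV.
rewrite linearZ/= => /eqP; rewrite scaler_eq0 invr_eq0 normr_eq0 (negbTE x0)/=.
by move/eqP.
Qed.

HB.instance Definition _ :=
  Lmodule_isNormed.Build R 'L(X, Y) normD normZ norm_eq0.

Lemma operator_normE T : `|T| = sup [set `|T x| | x in [set x | `|x| <= 1]].
Proof. by []. Qed.

End boundedOperator.

Section bhatia_semrl.
Variable R : realType.

Definition birkhoff_orth (V : normedModType R) (x y : V) :=
  forall l : R, `|x| <= `|x + l *: y|.

Definition strong_birkhoff_orth (V : normedModType R) (x y : V) :=
  forall l : R, l != 0 -> `|x| < `|x + l *: y|.

Variables X Y : normedModType R.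

Definition unit_sphere : set X := [set x | `|x| = 1].

Definition norming_set (T : 'L(X, Y)) : set X :=
  [set x | unit_sphere x /\ `|T x| = `|T|].

Definition norm_attaining : set 'L(X, Y) := [set T | norming_set T !=set0].

Definition BS_adjusted : set 'L(X, Y) :=
  [set T | norm_attaining T /\
    forall S : 'L(X, Y), strong_birkhoff_orth T S ->
      exists2 x0, norming_set T x0 & birkhoff_orth (T x0) (S x0)].

End bhatia_semrl.

Arguments BS_adjusted {R} X Y.

(* X^* with the weak-* topology, i.e. the topology of pointwise convergence. *)
Definition weak_star (R : realType) (X : normedModType R) : topologicalType :=
  initial_topology (fun phi : 'L(X, R^o) => (phi : {ptws X -> R^o})).

(* Main.v *)
(* Finite combinations T = sum_j a_j delta_(x_j) of evaluations are weak-*-dense,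
   since an element on which they all vanish is zero. Each of them has the
   adjusted Bhatia-Semrl property. Indeed T attains its norm on the convex set F
   of all f in the unit ball with f(x_j) = sgn(a_j), so a functional S without
   zeros on F has constant sign there, say S >= 0. If f is in the unit ball and
   d = sum_j (1 - sgn(a_j) f(x_j)), then f lies within d of F, whence
   S f >= - ||S|| d, whereas ||T|| - T f >= min_j |a_j| d. Hence
   ||T - l S|| <= ||T|| for small l > 0, and T is not strongly orthogonal to S.
   The argument only uses a norming family of point evaluations, a truncation at
   level 1 and bump functions, so that l^oo is treated like C(K), with the
   points of N only and without the Stone-Cech compactification. *)
From HB Require Import structures.
Require Import Defs.
From mathcomp Require Import all_boot all_order all_algebra.
From mathcomp Require Import all_classical all_reals all_analysis.
From mathcomp Require Import ring lra.
Import Order.TTheory GRing.Theory Num.Theory.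
Import numFieldNormedType.Exports.
Set Implicit Arguments.
Unset Strict Implicit.
Unset Printing Implicit Defensive.
Local Open Scope classical_set_scope.
Local Open Scope ring_scope.

(** * Norming families of evaluations, truncation and operator norm bounds *)

Record evaluation_system (R : realType) (X : normedModType R) (K : choiceType)
    (ev : K -> 'L(X, R^o)) : Prop := EvaluationSystem {
  ev_le_norm : forall t x, `|ev t x| <= `|x|;
  norm_le_ev : forall x M, 0 <= M -> (forall t, `|ev t x| <= M) -> `|x| <= M;
  ev_clip : forall x, exists y, forall t,
    ev t y = Num.max (-1) (Num.min 1 (ev t x) : R);
  ev_bump : forall t (s : seq K), t \notin s ->
    exists u, [/\ `|u| <= 1, ev t u = 1 & {in s, forall t', ev t' u = 0}]
}.

Lemma clip_bound (R : realType) (e : R) : `|Num.max (-1) (Num.min 1 e)| <= 1.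
Proof. by rewrite ler_norml le_max lexx ge_max ge_min lexx/= andbT; lra. Qed.

Lemma clip_id (R : realType) (e : R) :
  `|e| <= 1 -> Num.max (-1) (Num.min 1 e) = e.
Proof.
rewrite ler_norml => /andP[? ?].
by rewrite (min_idPr _)// (max_idPr _).
Qed.

(** Truncation is 1-Lipschitz and fixes [e], so clipping a perturbation of [e] moves it no further
    than the perturbation did. *)
Lemma clip_contraction (R : realType) (e w : R) : `|e| <= 1 ->
  `|Num.max (-1) (Num.min 1 (e + w)) - e| <= `|w|.
Proof.
rewrite ler_norml => /andP[? ?]; have := ler_norm w; have := ler_norm (- w).
rewrite normrN ler_norml => ? ?.
have [?|?] := leP 1 (e + w); first by rewrite max_r; lra.
by have [?|?] := leP (-1) (e + w); lra.
Qed.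

Lemma operator_norm_ub (R : realType) (X Y : normedModType R) (S : 'L(X, Y)) x :
  `|x| <= 1 -> `|S x| <= `|S|.
Proof. move=> x1; apply: sup_norm_ub => //; exact: operator_bounded_in. Qed.

Lemma operator_norm_le (R : realType) (X Y : normedModType R) (S : 'L(X, Y)) M :
  0 <= M -> (forall x, `|x| <= 1 -> `|S x| <= M) -> `|S| <= M.
Proof. by move=> M0 SM; exact: sup_norm_le. Qed.

Lemma operator_normM (R : realType) (X Y : normedModType R) (S : 'L(X, Y)) x :
  `|S x| <= `|S| * `|x|.
Proof.
have [->|x0] := eqVneq x 0; first by rewrite linear0 !normr0 mulr0.
have := @operator_norm_ub _ _ _ S (`|x|^-1 *: x).
rewrite normfZV// lexx => /(_ isT).
by rewrite linearZ/= normrZ normfV normr_id ler_pdivrMl ?normr_gt0// mulrC.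
Qed.

Lemma sum_operatorE (R : realType) (X Y : normedModType R) (I : Type) (s : seq I)
    (P : pred I) (F : I -> 'L(X, Y)) x :
  (\sum_(i <- s | P i) F i) x = \sum_(i <- s | P i) F i x.
Proof. by elim/big_ind2 : _ => // ? ? ? ? <- <-. Qed.

(** If [S] took opposite signs at two points of [F], it would vanish somewhere on the segment
    between them, which lies in [F]. *)
Lemma convex_zero_or_sign (R : realType) (X : normedModType R)
    (S : 'L(X, R^o)) (F : set X) :
  F !=set0 ->
  (forall y z l, F y -> F z -> 0 <= l <= 1 -> F (l *: y + (1 - l) *: z)) ->
  (exists2 y, F y & S y = 0) \/
  exists2 e : R, `|e| = 1 & forall y, F y -> 0 <= e * S y.
Proof.
move=> [y0 Fy0] cF.
have [|nz] := pselect (exists2 y, F y & S y = 0); first by left.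
have S0 y : F y -> S y != 0 by move=> Fy; apply/eqP => Sy; apply: nz; exists y.
right; exists (Num.sg (S y0)); first by rewrite normr_sg S0.
move=> y Fy; rewrite leNgt; apply/negP => neg; apply: nz.
pose p : R := `|S y0|; pose q : R := - (Num.sg (S y0) * S y).
have p0 : 0 < p by rewrite normr_gt0 S0.
have q0 : 0 < q by rewrite oppr_gt0.
(* With [g] the sign of [S y0], the values are [S y = - g * q] and [S y0 = g * p]; this weight makes
   them cancel. *)
exists (p / (p + q) *: y + (1 - p / (p + q)) *: y0).
  apply: cF => //; apply/andP; split; first by rewrite divr_ge0 ?addr_ge0 ?ltW.
  by rewrite ler_pdivrMr ?addr_gt0// mul1r lerDl ltW.
have Sy : S y = - Num.sg (S y0) * q.
  by rewrite /q mulrNN mulrA -expr2 sqr_sg S0// mul1r.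
have pq : p + q != 0 by rewrite gt_eqF ?addr_gt0.
rewrite linearD !linearZ/= Sy [X in _ + _ *: X](numEsg (S y0)) -/p /GRing.scale/=.
by field.
Qed.

Section evaluation_system_theory.
Variables (R : realType) (X : normedModType R) (K : choiceType).
Variables (ev : K -> 'L(X, R^o)) (evP : evaluation_system ev).

(** * The adjusted property for finite combinations with nonzero coefficients *)

Section finitely_supported.
Variables (s : seq K) (a : K -> R).
Hypotheses (us : uniq s) (s0 : s != [::]) (a0 : {in s, forall t, a t != 0}).

Let T : 'L(X, R^o) := \sum_(t <- s) a t *: ev t.
Let N : R := \sum_(t <- s) `|a t|.
Let face : set X :=
  [set y | `|y| <= 1 /\ {in s, forall t, ev t y = Num.sg (a t)}].
Let deficit (g : X) : R := \sum_(t <- s) (1 - Num.sg (a t) * ev t g).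

Let TE x : T x = \sum_(t <- s) a t * ev t x.
Proof. by rewrite /T sum_operatorE. Qed.

Let N_ge0 : 0 <= N. Proof. exact: sumr_ge0. Qed.

(** Since [a t] is [|a t|] times its sign, the gap below [N] is a weighted sum of one deficit per
    point. This yields the bound on the unit ball, equality on [face] and the growth of the gap away
    from [face]. *)
Let TN g : N - T g = \sum_(t <- s) `|a t| * (1 - Num.sg (a t) * ev t g).
Proof.
rewrite TE -sumrB; apply: eq_bigr => t _.
by rewrite mulrBr mulr1 mulrA -[_ * Num.sg _]mulrC -numEsg.
Qed.

Let deficit_ge0 g t : `|g| <= 1 -> 0 <= 1 - Num.sg (a t) * ev t g.
Proof.
move=> g1; rewrite subr_ge0 (le_trans (ler_norm _))// normrM normr_sg.
by rewrite mulr_ile1// ?(le_trans (ev_le_norm evP _ _))//; case: (_ != 0).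
Qed.

(* Correcting the values of g at the points of s costs at most the deficit of
   g; truncating at level 1 is harmless as `|g| <= 1. *)
Let face_near g : `|g| <= 1 -> exists2 h, face h & `|h - g| <= deficit g.
Proof.
move=> g1.
have /choice[u uP] t : exists u, [/\ `|u| <= 1, ev t u = 1 &
    {in s, forall t', t' != t -> ev t' u = 0}].
  have [|u [u1 ut us']] := @ev_bump _ _ _ _ evP t [seq t' <- s | t' != t].
    by rewrite mem_filter eqxx.
  by exists u; split => // t' t's t't; apply: us'; rewrite mem_filter t't.
pose w := \sum_(t <- s) (Num.sg (a t) - ev t g) *: u t.
have [h hP] := ev_clip evP (g + w).
have evg t : `|ev t g| <= 1 by rewrite (le_trans (ev_le_norm evP _ _)).
have wt : {in s, forall t, ev t w = Num.sg (a t) - ev t g}.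
  move=> t ts; rewrite linear_sum (bigD1_seq t)//= linearZ/=.
  have [_ -> _] := uP t; rewrite big1_seq ?addr0; first by rewrite /GRing.scale/= mulr1.
  move=> t' /andP[t't t's]; rewrite linearZ/=.
  by have [_ _ ->] := uP t'; rewrite ?scaler0// eq_sym.
exists h.
  split; first by apply: (norm_le_ev evP) => // t; rewrite hP clip_bound.
  move=> t ts; rewrite hP linearD/= wt// addrC subrK clip_id//.
  by rewrite normr_sg; case: (_ != 0).
have wd : `|w| <= deficit g.
  rewrite (le_trans (ler_norm_sum _ _ _))// big_seq [leRHS]big_seq ler_sum//.
  move=> t ts; rewrite normrZ; have [u1 _ _] := uP t.
  (* The sign squares to 1, so multiplying by it inside the absolute value turns the difference into
     the nonnegative deficit at [t]. *)
  have -> : `|Num.sg (a t) - ev t g| = 1 - Num.sg (a t) * ev t g.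
    rewrite -[RHS]ger0_norm ?deficit_ge0//.
    have e1 : Num.sg (a t) * Num.sg (a t) = 1.
      by rewrite -expr2 sqr_sg a0.
    by rewrite -{1}e1 -mulrBr normrM normr_sg a0//= mul1r.
  by rewrite ler_piMr// deficit_ge0.
apply: le_trans wd; apply: (norm_le_ev evP) => // t.
rewrite linearB/= hP linearD/=; apply: le_trans (ev_le_norm evP t w).
exact: clip_contraction.
Qed.

Let face_nonempty : face !=set0.
Proof. by have [|h] := face_near (g := 0); [rewrite normr0|exists h]. Qed.

Let T_face y : face y -> T y = N.
Proof.
move=> [y1 yP]; apply/eqP; rewrite eq_sym -subr_eq0 TN big1_seq// => t /andP[_ ts].
by rewrite yP// -expr2 sqr_sg a0// subrr mulr0.
Qed.

Let T_le g : `|g| <= 1 -> T g <= N.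
Proof.
move=> g1; rewrite -subr_ge0 TN big_seq sumr_ge0// => t ts.
by rewrite mulr_ge0// deficit_ge0.
Qed.

Let normT : `|T| = N.
Proof.
apply/le_anti/andP; split.
  apply: operator_norm_le => // x x1; rewrite ler_norml T_le// andbT.
  by rewrite lerNl -linearN T_le ?normrN.
have [y Fy] := face_nonempty; rewrite -(T_face Fy).
by rewrite (le_trans (ler_norm _))// operator_norm_ub//; case: Fy.
Qed.

Let face_norming y : face y -> norming_set T y.
Proof.
move=> Fy; split; last by rewrite normT T_face// ger0_norm.
have [y1 yP] := Fy; apply/eqP; rewrite eq_le y1/=.
(* At any point of the nonempty list [s] the value of [y] is a sign, which forces the norm of [y] up
   to 1. *)
case: s s0 yP a0 => //= t s' _ yP a0'.
rewrite (le_trans _ (ev_le_norm evP t y))// yP ?mem_head// normr_sg.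
by rewrite a0' ?mem_head.
Qed.

Let face_convex y z l : face y -> face z -> 0 <= l <= 1 ->
  face (l *: y + (1 - l) *: z).
Proof.
move=> [y1 yP] [z1 zP] /andP[l0 l1]; split.
  rewrite (le_trans (ler_normD _ _))// !normrZ !ger0_norm ?subr_ge0//.
  by have := ler_wpM2l l0 y1; have : (1 - l) * `|z| <= (1 - l) * 1;
    [rewrite ler_wpM2l ?subr_ge0|lra].
move=> t ts; rewrite linearD !linearZ/= yP// zP// /GRing.scale/=; ring.
Qed.

Let pos_face_not_orth (S : 'L(X, R^o)) : (forall y, face y -> 0 <= S y) ->
  exists2 l : R, l != 0 & `|T + l *: S| <= `|T|.
Proof.
move=> S0.
(* The smallest mass, with 1 as the value for the empty list in the induction. *)
have [m m0 ma] : exists2 m : R, 0 < m & {in s, forall t, m <= `|a t|}.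
  elim: s a0 => [|t s' IH] aN0; first by exists 1.
  have [t' t's'|m m0 ma] := IH; first by apply: aN0; rewrite inE t's' orbT.
  exists (Num.min m `|a t|).
    by rewrite lt_min m0 normr_gt0 aN0 ?mem_head.
  by move=> t'; rewrite inE ge_min => /predU1P[->|/ma->//]; rewrite lexx orbT.
have S1 : 0 < `|S| + 1 by rewrite ltr_wpDl.
(* This gives [l * |S| <= m], so the possible increase due to [S] is absorbed by the gap of [T];
   adding 1 covers [S = 0]. *)
pose l := m / (`|S| + 1); have l0 : 0 < l by rewrite divr_gt0.
have key g : `|g| <= 1 -> (T + (- l) *: S) g <= N.
  move=> g1; rewrite -[(T + _) g]/(T g + (- l) * S g).
  have [h Fh hg] := face_near g1.
  have Sg : - (`|S| * deficit g) <= S g.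
    have : S h - S g <= `|S| * deficit g.
      rewrite -linearB (le_trans (ler_norm _))//.
      by rewrite (le_trans (operator_normM _ _))// ler_wpM2l.
    by have := S0 _ Fh; lra.
  have TNg : m * deficit g <= N - T g.
    rewrite TN mulr_sumr big_seq [leRHS]big_seq ler_sum// => t ts.
    by rewrite ler_wpM2r ?deficit_ge0 ?ma.
  have d0 : 0 <= deficit g by apply: sumr_ge0 => t _; exact: deficit_ge0.
  have lm : l * (`|S| * deficit g) <= m * deficit g.
    rewrite mulrA ler_wpM2r// /l -mulrA ler_piMr ?(ltW m0)//.
    by rewrite ler_pdivrMl// mulr1 lerDl.
  by have := ler_wpM2l (ltW l0) Sg; lra.
exists (- l); first by rewrite oppr_eq0 gt_eqF.
(* The unit ball is symmetric, so [key] at [- x] supplies the lower bound. *)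
rewrite normT; apply: operator_norm_le => // x x1.
rewrite ler_norml key// andbT lerNl -linearN key//.
by rewrite normrN.
Qed.

(** A zero of [S] on [face] is a norming point with trivial orthogonality. Otherwise [e *: S] is
    nonnegative on [face], and the resulting nonzero coefficient [l * e] contradicts strong
    orthogonality. *)
Lemma finitely_supported_BS_adjusted : BS_adjusted X R^o T.
Proof.
split; first by have [y Fy] := face_nonempty; exists y; exact: face_norming.
move=> S TS; have [[y Fy Sy]|[e e1 eS]] := convex_zero_or_sign S face_nonempty face_convex.
  exists y; first exact: face_norming.
  by move=> l; rewrite Sy scaler0 addr0.
have [l l0] := pos_face_not_orth (S := e *: S) eS.
rewrite scalerA leNgt TS// mulf_neq0//.
by rewrite -normr_gt0 e1.
Qed.

End finitely_supported.

(** Every unit vector norms the zero functional; a bump at [t0] provides one. *)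
Lemma zero_BS_adjusted (t0 : K) : BS_adjusted X R^o 0.
Proof.
have [u [u1 ut _]] := @ev_bump _ _ _ _ evP t0 [::] isT.
have nu : norming_set (0 : 'L(X, R^o)) u.
  split; last by rewrite -[(0 : 'L(X, R^o)) u]/(0 : R^o) !normr0.
  by apply/eqP; rewrite eq_le u1/= (le_trans _ (ev_le_norm evP t0 u))// ut normr1.
split; first by exists u.
by move=> S _; exists u => // l; rewrite -[(0 : 'L(X, R^o)) u]/(0 : R^o) normr0.
Qed.

(** * Atomic functionals: adjusted property and linear structure *)

Definition atomic (D : 'L(X, R^o)) := exists (s : seq K) (a : K -> R),
  uniq s /\ D = \sum_(t <- s) a t *: ev t.

Lemma atomic_BS_adjusted (t0 : K) D : atomic D -> BS_adjusted X R^o D.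
Proof.
move=> [s [a [us ->]]].
(* Points of zero mass are dropped, to reach nonzero coefficients. *)
have -> : \sum_(t <- s) a t *: ev t =
    \sum_(t <- [seq t <- s | a t != 0]) a t *: ev t.
  rewrite big_filter [LHS](bigID (fun t => a t != 0))/= [X in _ + X]big1 ?addr0//.
  by move=> t /negbNE/eqP ->; rewrite scale0r.
have [->|s0] := eqVneq [seq t <- s | a t != 0] [::].
  by rewrite big_nil; exact: zero_BS_adjusted t0.
apply: finitely_supported_BS_adjusted => //; first exact: filter_uniq.
by move=> t; rewrite mem_filter => /andP[].
Qed.

Lemma atomic0 : atomic 0.
Proof. by exists [::], (fun=> 0); rewrite big_nil. Qed.

Lemma atomic_ev t : atomic (ev t).
Proof. by exists [:: t], (fun=> 1); rewrite big_seq1 scale1r. Qed.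

Lemma atomicZ c D : atomic D -> atomic (c *: D).
Proof.
move=> [s [a [us ->]]]; exists s, (fun t => c * a t); split=> //.
by rewrite scaler_sumr; apply: eq_bigr => t _; rewrite scalerA.
Qed.

Lemma atomicD D E : atomic D -> atomic E -> atomic (D + E).
Proof.
(* Padding with zero coefficients lets both sums run over one duplicate-free list. *)
have widen (s r : seq K) (a : K -> R) :
      uniq s -> uniq r -> {subset s <= r} ->
    \sum_(t <- s) a t *: ev t =
      \sum_(t <- r) (if t \in s then a t else 0) *: ev t.
  move=> us ur sr.
  rewrite [RHS](bigID (mem s))/= [X in _ + X]big1 ?addr0; last first.
    by move=> t /negbTE ->; rewrite scale0r.
  transitivity (\sum_(t <- r | t \in s) a t *: ev t); last first.
    by apply: eq_bigr => t ->.
  rewrite -[RHS]big_filter; apply: perm_big; apply: uniq_perm; rewrite ?filter_uniq// => t.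
  by rewrite mem_filter; apply/idP/andP => [ts|[]//]; split=> //; exact: sr.
move=> [s [a [us ->]]] [s' [a' [us' ->]]].
have ur := undup_uniq (s ++ s').
rewrite (widen _ _ a us ur) 1?(widen _ _ a' us' ur); last 2 first.
- by move=> t ts; rewrite mem_undup mem_cat ts orbT.
- by move=> t ts; rewrite mem_undup mem_cat ts.
exists (undup (s ++ s')), (fun t => (if t \in s then a t else 0) +
  if t \in s' then a' t else 0); split=> //.
by rewrite -big_split/=; apply: eq_bigr => t _; rewrite scalerDl.
Qed.

(* Algebraic Hahn-Banach for the span of the evaluations: an x which is not
   determined by fs is detected by an atomic functional vanishing on fs. *)
Lemma atomic_separation (fs : seq X) (x : X) :
  (forall D : 'L(X, R^o), {in fs, forall f, D f = 0} -> D x = 0) \/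
  exists2 D, atomic D & {in fs, forall f, D f = 0} /\ D x = 1.
Proof.
elim: fs x => [|f fs IH] x.
  have [->|x0] := eqVneq x 0; first by left=> D _; rewrite linear0.
  have [t evx] : exists t, ev t x != 0.
    apply: contrapT => /forallNP ev0; move/negP: x0; apply.
    rewrite -normr_le0; apply: (norm_le_ev evP) => // t.
    by have /negP/negbNE/eqP -> := ev0 t; rewrite normr0.
  right; exists ((ev t x)^-1 *: ev t); first exact/atomicZ/atomic_ev.
  by split=> //; exact: mulVf.
(* Either [f] is determined by [fs] and adds no constraint, or [D0] detects it and [x] can be moved
   along [f] into the kernel of [D0]. *)
have [fD|[D0 aD0 [D0fs D0f]]] := IH f.
  have [xD|[D aD [Dfs Dx]]] := IH x; [left|right].
    by move=> D Dfs; apply: xD => g gfs; apply: Dfs; rewrite inE gfs orbT.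
  exists D => //; split=> // g; rewrite inE => /predU1P[->|/Dfs//].
  exact: fD.
have [xD|[D1 aD1 [D1fs D1x]]] := IH (x - D0 x *: f); [left|right].
  move=> D Dfs; have : D (x - D0 x *: f) = 0.
    by apply: xD => g gfs; apply: Dfs; rewrite inE gfs orbT.
  by rewrite linearB linearZ/= (Dfs f) ?mem_head// scaler0 subr0.
(* The correction kills [f], and the value at [x] equals [D1 (x - D0 x *: f) = 1]. *)
exists (D1 + (- D1 f) *: D0); first exact/atomicD/atomicZ.
have DE y : (D1 + (- D1 f) *: D0) y = D1 y - D1 f * D0 y.
  by rewrite -mulNr.
split=> [g|]; last first.
  by rewrite DE mulrC; move: D1x; rewrite linearB linearZ.
rewrite DE inE => /predU1P[->|gfs]; first by rewrite D0f mulr1 subrr.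
by rewrite D1fs// D0fs// mulr0 subrr.
Qed.

(** By induction: if [f] is determined by [fs], then [D - phi] already vanishes at [f]; otherwise a
    multiple of [E] repairs the value at [f] and leaves those on [fs] unchanged. *)
Lemma atomic_interpolation (fs : seq X) (phi : 'L(X, R^o)) :
  exists2 D, atomic D & {in fs, forall f, D f = phi f}.
Proof.
elim: fs => [|f fs [D aD Dfs]]; first by exists 0 => //; exact: atomic0.
have [fD|[E aE [Efs Ef]]] := atomic_separation fs f.
  exists D => // g; rewrite inE => /predU1P[->|/Dfs//].
  apply/eqP; rewrite -subr_eq0 -[_ - _]/((D - phi) f); apply/eqP/fD => h hfs.
  by rewrite -[LHS]/(D h - phi h) Dfs// subrr.
exists (D + (phi f - D f) *: E); first exact/atomicD/atomicZ.
move=> g; rewrite -[(D + _) g]/(D g + (phi f - D f) * E g) inE.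
move=> /predU1P[->|gfs]; first by rewrite Ef mulr1 addrC subrK.
by rewrite Efs// mulr0 addr0 Dfs.
Qed.

(** The sets [A fs] generate a filter converging pointwise to [phi]. Hence [O] contains some [A fs],
    and interpolation gives an element of it. *)
Lemma atomic_dense : @dense (weak_star X) [set D | atomic D].
Proof.
move=> O [phi Ophi] oO.
pose A (fs : seq X) := [set D | atomic D /\ {in fs, forall f, D f = phi f}].
pose F : set_system (weak_star X) := [set B | exists fs : seq X, A fs `<=` B].
have FF : Filter F.
  split.
  - by exists [::].
  - move=> B C [fs AB] [gs AC]; exists (fs ++ gs) => D [aD Dphi]; split.
      by apply: AB; split=> // f ffs; apply: Dphi; rewrite mem_cat ffs.
    by apply: AC; split=> // f ffs; apply: Dphi; rewrite mem_cat ffs orbT.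
  - by move=> B C BC [fs AB]; exists fs; exact: subset_trans BC.
pose i (D : weak_star X) : {ptws X -> R^o} := (D : 'L(X, R^o)).
have Fphi : {ptws, i @ F --> i phi}.
  apply/pointwise_cvgP => f B /nbhs_singleton Bphi.
  by exists [:: f] => D [_ /(_ f (mem_head _ _)) Dphi]; rewrite /= /i Dphi.
have [U oU UO] := oO.
have [fs AO] : F O.
  by rewrite -UO; apply: Fphi; apply: open_nbhs_nbhs; split=> //; rewrite -UO in Ophi.
have [D aD Dphi] := atomic_interpolation fs phi.
by exists D; split=> //; apply: AO.
Qed.

Lemma BS_adjusted_dense (t0 : K) : @dense (weak_star X) (BS_adjusted X R^o).
Proof.
move=> O O0 oO; have [D [OD aD]] := atomic_dense O0 oO.
by exists D; split=> //; exact: (atomic_BS_adjusted t0).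
Qed.

End evaluation_system_theory.

(** * Evaluations on [C(K)] *)

Section Cspace_evaluation.
Variables (R : realType) (K : topologicalType) (cK : compact [set: K]).

Definition Cspace_eval (t : K) (f : Cspace R cK) : R^o := f t.

Section instances.
Variable t : K.

Let eval_linear : linear (Cspace_eval t). Proof. by []. Qed.

HB.instance Definition _ := GRing.isLinear.Build R (Cspace R cK) R^o *:%R
  (Cspace_eval t) eval_linear.

Let eval_bounded : exists M : R, forall f, `|Cspace_eval t f| <= M * `|f|.
Proof.
by exists 1 => f; rewrite mul1r; exact: (sup_norm_ub (Cspace_bounded f) I).
Qed.

HB.instance Definition _ := isBoundedOperator.Build R (Cspace R cK) R^o
  (Cspace_eval t) eval_bounded.

End instances.

Lemma Cspace_evaluation_system : hausdorff_space K ->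
  @evaluation_system R (Cspace R cK) K (fun t => Cspace_eval t).
Proof.
move=> hK; split.
- by move=> t f; exact: (sup_norm_ub (Cspace_bounded f) I).
- by move=> f M M0 fM; apply: sup_norm_le => // t _; exact: fM.
- move=> f.
  have cf : continuous (cst (-1 : R^o) \max (cst (1 : R^o) \min (f : K -> R^o))).
    move=> t; apply: continuous_max; first exact: cvg_cst.
    by apply: continuous_min; [exact: cvg_cst|exact: Cspace_cts].
  by exists (Cspace_mk cK cf).
- move=> t s ts.
  (* Urysohn: a compact Hausdorff space is normal and its finite sets are closed, so [s] and [t] are
     separated by a function into [[0, 1]]. *)
  have T1 := accessible_finite_set_closed.1 (hausdorff_accessible hK).
  have st0 : [set` s] `&` [set t] = set0.
    by rewrite -subset0 => _ [/= /[swap] ->]; exact/negP.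
  have [u [cu u01 us ut]] := (@uniform_separatorP K R [set` s] [set t]).1
    (normal_uniform_separator (compact_normal hK cK) (T1 _ (finite_seq s))
      (T1 _ (finite_set1 t)) st0).
  exists (Cspace_mk cK cu); split.
  + apply: sup_norm_le => // x _.
    by have := u01 _ (imageT u x); rewrite /= in_itv/= => /andP[u0 u1]; rewrite ger0_norm.
  + by apply: ut; exists t.
  + by move=> t' t's; apply: us; exists t'.
Qed.

End Cspace_evaluation.

(** * Coordinate evaluations on [l^oo] *)

Section linfty_evaluation.
Variable R : realType.

Definition linfty_eval (n : nat) (u : linfty R) : R^o := u n.

Section instances.
Variable n : nat.

Let eval_linear : linear (linfty_eval n). Proof. by []. Qed.

HB.instance Definition _ := GRing.isLinear.Build R (linfty R) R^o *:%R
  (linfty_eval n) eval_linear.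

Let eval_bounded : exists M : R, forall f, `|linfty_eval n f| <= M * `|f|.
Proof.
by exists 1 => f; rewrite mul1r; exact: (sup_norm_ub (linfty_bounded _) I).
Qed.

HB.instance Definition _ := isBoundedOperator.Build R (linfty R) R^o
  (linfty_eval n) eval_bounded.

End instances.

Lemma linfty_evaluation_system :
  @evaluation_system R (linfty R) nat (fun n => linfty_eval n).
Proof.
have mk (v : nat -> R^o) : (forall n, `|v n| <= 1) ->
    exists2 y : linfty R, `|y| <= 1 & linfty_fun y = v.
  move=> v1; have bv : v \in bounded_seq by apply/bounded_seqP; exists 1.
  by exists (exist _ v bv) => //; apply: sup_norm_le => // n _; exact: v1.
split.
- by move=> n u; exact: (sup_norm_ub (linfty_bounded _) I).
- by move=> u M M0 uM; apply: sup_norm_le => // t _; exact: uM.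
- move=> u; have [|y _ yE] := mk (fun n => Num.max (-1) (Num.min 1 (linfty_fun u n))).
    by move=> n; exact: clip_bound.
  by exists y => n; rewrite /= /linfty_eval yE.
(* The indicator sequence of [n] serves as the bump, whatever [s] is. *)
- move=> n s ns; have [|y y1 yE] := mk (fun m => (m == n)%:R).
    by move=> m; rewrite normr_nat lern1 leq_b1.
  exists y; split=> //=; rewrite /linfty_eval yE ?eqxx// => m ms.
  by case: eqP ms ns => // -> ->.
Qed.

End linfty_evaluation.

Theorem mainTheorem7 (R : realType) :
  (forall (K : topologicalType) (cK : compact [set: K]),
     hausdorff_space K -> [set: K] !=set0 ->
     @dense (weak_star (Cspace R cK)) (BS_adjusted (Cspace R cK) R^o)) /\
  @dense (weak_star (linfty R)) (BS_adjusted (linfty R) R^o).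
Proof.
split; last exact: BS_adjusted_dense (linfty_evaluation_system R) 0%N.
move=> K cK hK [t0 _].
exact: BS_adjusted_dense (Cspace_evaluation_system R cK hK) t0.
Qed.
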